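(* Suppose that $\mathcal A$ is the Bayesian strategy for the prior $\mu$ (a probability measure on $\mathbb{R}^d$) and that $\mathcal B$ is an optimal agnostic strategy in the additive or multiplicative regret setting. Then, respectively: (i) (Additive regret setting.) $$\int \operatorname{AR}_{\mathcal A}(\mathbf a)\,d\mu(\mathbf a)\;\le\;\operatorname{AR}^*_{\mathcal B}\;\le\;\operatorname{AR}^*_{\mathcal A};$$ (ii) (Multiplicative regret setting.) $$\frac{\int \operatorname{MR}_{\mathcal A}(\mathbf a)\,J_o(\mathbf a)\,d\mu(\mathbf a)}{\int J_o(\mathbf a)\,d\mu(\mathbf a)}\;\le\;\operatorname{MR}^*_{\mathcal B}\;\le\;\operatorname{MR}^*_{\mathcal A}.$$
   Context: Fix $0\le T_0<T$ and a dimension $d$. For a drift parameter $\mathbf a\in\mathbb{R}^d$ consider the controlled system $$d\mathbf q(t)=(\mathbf a+\mathbf u(t))\,dt+d\mathbf W(t),\qquad d\mathbf y(t)=\mathbf q(t)\,dt+d\mathbf V(t),\qquad \mathbf y(0)=0,$$ with state $\mathbf q(t)\in\mathbb{R}^d$ and observation $\mathbf y(t)\in\mathbb{R}^d$. Here $\mathbf W,\mathbf V$ are independent $d$-dimensional scaled Wiener processes with covariances $\Sigma_W t$ ($\Sigma_W=I$) and $\Sigma_V t$ ($\Sigma_V$ symmetric positive definite), and $\mathbf q(0)$ is normally distributed with $\mathbb{E}[\mathbf q(0)\mathbf q(0)^T]=\Sigma_{\mathbf q_0}$, independent of $\mathbf W,\mathbf V$ (and of $\mathbf a$ when $\mathbf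 a$ is random). A strategy is a rule giving the control $\mathbf u(t)\in\mathbb{R}^d$ as a function of the measurements $\{\mathbf y(\tau):0\le\tau<t\}$, with no control applied ($\mathbf u(t)=0$) for $t<T_0$; it does not have access to $\mathbf a$. The cost of a strategy $\mathcal B$ at parameter value $\mathbf a$ is $$J_{\mathcal B}(\mathbf a)=\mathbb{E}\Big[\int_{T_0}^T(\mathbf q^TQ\mathbf q+\mathbf u^TR\mathbf u)\,dt\Big],$$ where $Q$ and $R$ are the fixed weight matrices of a standard linear-quadratic-Gaussian problem ($Q$ symmetric positive semidefinite, $R$ symmetric positive definite). $J_o(\mathbf a)$ denotes the cost at $\mathbf a$ of the optimal strategy with full knowledge of $\mathbf a$; thus $J_o(\mathbf a)\le J_{\mathcal B}(\mathbf a)$ for all strategies $\mathcal B$ and all $\mathbf a$. The Bayesian strategy for a prior probability measure $\mu$ on $\mathbb{R}^d$ is the strategy that minimizes the expected cost $\int J_{\mathcal B}(\mathbf a)\,d\mu(\mathbf a)$ over all strategies $\mathcal B$. Additive regret: $\operatorname{AR}_{\mathcal B}(\mathbf a)=J_{\mathcal B}(\mathbf a)-J_o(\mathbf a)\ge0$, with worst case $\operatorname{AR}^*_{\mathcal B}=\sup_{\mathbf a}\operatorname{AR}_{\mathcal B}(\mathbf a)$. Multiplicative regret: $\operatorname{MR}_{\mathcal B}(\mathbf a)=J_{\mathcal B}(\mathbf a)/J_o(\mathbf a)\ge1$, with worst case $\operatorname{MR}^*_{\mathcal B}=\sup_{\mathbf a}\operatorname{MR}_{\mathcal B}(\mathbf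 a)$. Suprema are over all $\mathbf a\in\mathbb{R}^d$. An optimal agnostic strategy in the additive (resp. multiplicative) regret setting is a strategy minimizing $\operatorname{AR}^*$ (resp. $\operatorname{MR}^*$) over all strategies.
   Formalization: The formal statement additionally assumes that the integral of J_o against the prior μ is finite; otherwise every strategy has infinite expected cost, so every strategy is Bayesian and (i) can fail, while the denominator in (ii) is infinite. *)

(* Defs.v *)
From HB Require Import structures.
From mathcomp Require Export all_boot all_order all_algebra.
From mathcomp Require Export all_classical all_reals all_analysis.

Set Implicit Arguments.
Unset Strict Implicit.
Unset Printing Implicit Defensive.

Import Order.TTheory GRing.Theory Num.Theory.
Export numFieldNormedType.Exports.

Local Open Scope classical_set_scope.
Local Open Scope ring_scope.

Definition psd (R : realType) (d : nat) (M : 'M[R]_d) : Prop :=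
  M^T = M /\ forall x : 'cV[R]_d, 0 <= (x^T *m M *m x) 0 0.

Definition pd (R : realType) (d : nat) (M : 'M[R]_d) : Prop :=
  M^T = M /\ forall x : 'cV[R]_d, x != 0 -> 0 < (x^T *m M *m x) 0 0.

(* R^d, as column vectors, with its Borel sigma-algebra. *)
Definition borel_vec (R : realType) (d : nat) :=
  g_sigma_algebraType (@open 'cV[R]_d).

(* [sigma I X] is the sigma-algebra generated by the X t for t in I. *)
Definition sigma (R : realType) (d : nat) (T : Type) (I : set R)
    (X : R -> T -> borel_vec R d) : set (set T) :=
  <<s \bigcup_(t in I) preimage_set_system setT (X t) measurable >>.

Section Probability.
Context {R : realType} {d : nat} {disp : measure_display}
  {Omega : measurableType disp} (P : probability Omega R).

Definition indep2 (F G : set (set Omega)) : Prop :=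
  forall A B, F A -> G B -> P (A `&` B) = (P A * P B)%E.

(* When F, G and H are sigma-algebras (hence contain the full set), this is
   mutual independence. *)
Definition indep3 (F G H : set (set Omega)) : Prop :=
  forall A B C, F A -> G B -> H C ->
    P (A `&` B `&` C) = (P A * P B * P C)%E.

(* The normal law on R with mean m and variance v >= 0; for v = 0 it is the
   point mass at m, whereas [normal_prob m 0] is a uniform law. *)
Definition normal_law (m v : R) (A : set R) : \bar R :=
  if v == 0 then \d_m A else normal_prob m (Num.sqrt v) A.

(* X is normal with mean m and covariance C (assumed positive semidefinite),
   possibly degenerate: every linear functional of X is normal. *)
Definition normal_vec (X : Omega -> borel_vec R d) (m : 'cV[R]_d)
    (C : 'M[R]_d) : Prop :=
  measurable_fun setT X /\
  forall (c : 'cV[R]_d) (A : set R), measurable A ->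
    P [set w | A ((c^T *m (X w : 'cV[R]_d)) 0 0)] =
    normal_law ((c^T *m m) 0 0) ((c^T *m C *m c) 0 0) A.

(* Scaled Wiener process on [0, +oo[ with covariance t *: Sigma. *)
Record wiener (Sigma : 'M[R]_d) (W : R -> Omega -> borel_vec R d) : Prop := {
  wiener0 : {ae P, forall w, (W 0 w : 'cV[R]_d) = 0};
  wiener_continuous :
    {ae P, forall w, {within `[0, +oo[, continuous
      ((fun t => W t w) : R -> 'cV[R]_d)}};
  wiener_measurable : forall t, 0 <= t -> measurable_fun setT (W t);
  wiener_normal : forall s t, 0 <= s -> s <= t ->
    normal_vec (fun w => (W t w : 'cV[R]_d) - (W s w : 'cV[R]_d))
      0 ((t - s) *: Sigma);
  wiener_indep : forall s t, 0 <= s -> s <= t ->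
    indep2 (sigma `[0, s] W)
      (preimage_set_system setT
        ((fun w => (W t w : 'cV[R]_d) - (W s w : 'cV[R]_d))
          : Omega -> borel_vec R d) measurable) }.

(* The data of the control problem on [0, T1]; control and cost start at T0.
   The mean of the initial state q0 is unconstrained and Sigmaq0 is its second
   moment. *)
Record lqg := Lqg {
  T0 : R;
  T1 : R;
  Qw : 'M[R]_d;
  Rw : 'M[R]_d;
  SigmaV : 'M[R]_d;
  Sigmaq0 : 'M[R]_d;
  q0 : Omega -> borel_vec R d;
  W : R -> Omega -> borel_vec R d;
  V : R -> Omega -> borel_vec R d;
  T0_ge0 : 0 <= T0;
  T0_lt_T1 : T0 < T1;
  Qw_psd : psd Qw;
  Rw_pd : pd Rw;
  SigmaV_pd : pd SigmaV;
  W_wiener : wiener 1%:M W;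
  V_wiener : wiener SigmaV V;
  q0_normal : exists (m : 'cV[R]_d) (C : 'M[R]_d), psd C /\ normal_vec q0 m C;
  q0_moment : forall i j,
    ('E_P[(fun w => (q0 w : 'cV[R]_d) i 0 * (q0 w : 'cV[R]_d) j 0)%R]
      = (Sigmaq0 i j)%:E)%E;
  noise_indep : indep3 (preimage_set_system setT q0 measurable)
    (sigma `[0, +oo[ W) (sigma `[0, +oo[ V) }.

(* The componentwise integral of f over [0, t]. *)
Definition vint (f : R -> 'cV[R]_d) (t : R) : 'cV[R]_d :=
  \col_i (\int[lebesgue_measure]_(r in `[0%R, t]) f r i 0)%R.

Definition vintegrable (f : R -> 'cV[R]_d) (t : R) : Prop :=
  forall i, (lebesgue_measure : measure _ R).-integrable `[0, t]
    (fun r => (f r i 0)%:E).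

(* The paths q and y solve, on [0, s], the integrated form of
     dq = (a + u) dt + dW,  dy = q dt + dV,  q(0) = q0,  y(0) = 0
   with u = B y, for the noise paths w and v.  The noise is additive, so no
   stochastic integral is involved. *)
Definition closed_loop (B : (R -> 'cV[R]_d) -> R -> 'cV[R]_d)
    (a x0 : 'cV[R]_d) (w v : R -> 'cV[R]_d) (s : R)
    (q y : R -> 'cV[R]_d) : Prop :=
  [/\ vintegrable (B y) s,
      vintegrable q s,
      (forall t, 0 <= t <= s ->
        q t = x0 + vint (fun r => a + B y r) t + w t) &
      (forall t, 0 <= t <= s -> y t = vint q t + v t)].

(* A strategy: a rule that maps an observation path to a control path, in such
   a way that u(t) is a measurable function of y on [0, t[ (hence depends on
   that part of y only), together with its closed-loop state and observation
   processes for every drift a.  These processes are determined by the rule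
   up to null sets: the closed loop is required to be pathwise well posed.
   Uniqueness on every [0, s], rather than on [0, T1] only, prevents the
   selection of the solution from anticipating the noise. *)
Record strategy (S : lqg) := Strategy {
  rule : (R -> 'cV[R]_d) -> R -> 'cV[R]_d;
  state : 'cV[R]_d -> Omega -> R -> 'cV[R]_d;
  obs : 'cV[R]_d -> Omega -> R -> 'cV[R]_d;
  rule_causal : forall (t : R) (A : set (borel_vec R d)), measurable A ->
    sigma `[0, t[ (fun r (y : R -> 'cV[R]_d) => y r) [set y | A (rule y t)];
  rule_off : forall y t, t < T0 S -> rule y t = 0;
  rule_solution : forall a, {ae P, forall w,
    closed_loop rule a (q0 S w) ((W S) ^~ w) ((V S) ^~ w) (T1 S)
      (state a w) (obs a w)};
  rule_unique : forall a, {ae P, forall w, forall s, 0 <= s <= T1 S ->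
    forall q y q' y' : R -> 'cV[R]_d,
      closed_loop rule a (q0 S w) ((W S) ^~ w) ((V S) ^~ w) s q y ->
      closed_loop rule a (q0 S w) ((W S) ^~ w) ((V S) ^~ w) s q' y' ->
      forall t, 0 <= t <= s -> q t = q' t /\ y t = y' t};
  state_measurable :
    measurable_fun [set: borel_vec R d * Omega * R]
      ((fun x => state x.1.1 x.1.2 x.2)
        : borel_vec R d * Omega * R -> borel_vec R d);
  control_measurable :
    measurable_fun [set: borel_vec R d * Omega * R]
      ((fun x => rule (obs x.1.1 x.1.2) x.2)
        : borel_vec R d * Omega * R -> borel_vec R d) }.

Definition control (S : lqg) (B : strategy S) (a : 'cV[R]_d) (w : Omega)
    (t : R) : 'cV[R]_d := rule B (obs B a w) t.

Local Open Scope ereal_scope.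

Definition cost (S : lqg) (B : strategy S) (a : 'cV[R]_d) : \bar R :=
  \int[P]_w \int[lebesgue_measure]_(t in `[T0 S, T1 S])
    (((state B a w t)^T *m Qw S *m state B a w t) 0%R 0%R
     + ((control B a w t)^T *m Rw S *m control B a w t) 0%R 0%R)%R%:E.

(* With full knowledge of a, the strategy may be chosen depending on a, so the
   optimal cost at a is the least cost at a over all strategies. *)
Definition opt_cost (S : lqg) (a : 'cV[R]_d) : \bar R :=
  ereal_inf (range (fun B : strategy S => cost B a)).

Definition expected_cost (S : lqg) (mu : probability (borel_vec R d) R)
    (B : strategy S) : \bar R := \int[mu]_a cost B a.

Definition bayesian (S : lqg) (mu : probability (borel_vec R d) R)
    (A : strategy S) : Prop :=
  forall B : strategy S, expected_cost mu A <= expected_cost mu B.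

Definition AR (S : lqg) (B : strategy S) (a : 'cV[R]_d) : \bar R :=
  cost B a - opt_cost S a.

Definition AR_worst (S : lqg) (B : strategy S) : \bar R :=
  ereal_sup (range (AR B)).

(* In the degenerate case opt_cost S a = 0 (e.g. Q = 0), the quotient is 0 if
   cost B a = 0 and +oo otherwise. *)
Definition MR (S : lqg) (B : strategy S) (a : 'cV[R]_d) : \bar R :=
  cost B a / opt_cost S a.

Definition MR_worst (S : lqg) (B : strategy S) : \bar R :=
  ereal_sup (range (MR B)).

Definition AR_agnostic (S : lqg) (B : strategy S) : Prop :=
  forall A : strategy S, AR_worst B <= AR_worst A.

Definition MR_agnostic (S : lqg) (B : strategy S) : Prop :=
  forall A : strategy S, MR_worst B <= MR_worst A.

End Probability.

(* Main.v *)
(* The optimal cost is an infimum over uncountably many strategies, so it is not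
   known to be measurable.  For a nonnegative function f, however, the integral
   is the supremum of the integrals of the simple functions below f, i.e. a
   lower integral, which without any measurability is monotone, superadditive,
   and satisfies I(f + k) <= I(f) + k and I(k f) <= k I(f) for constants k >= 0.
   Writing c_A, c_B for the costs and o for the optimal cost, this suffices:
   with k = AR*_B,
     I(c_A - o) + I(o) <= I(c_A) <= I(c_B) <= I(o + k) <= I(o) + k,
   and with k = MR*_B, I(c_A) <= I(c_B) <= I(k o) <= k I(o). *)
Require Import Defs.
From mathcomp Require Import measurable_realfun.
Import Order.TTheory GRing.Theory Num.Theory.
Import HBNNSimple.
Local Open Scope classical_set_scope.
Local Open Scope ring_scope.
Local Open Scope ereal_scope.

Lemma ge0_le_integral_nonmeas d (T : measurableType d) (R : realType)
    (mu : {measure set T -> \bar R}) (f g : T -> \bar R) :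
  (forall x, 0 <= f x) -> (forall x, f x <= g x) ->
  \int[mu]_x f x <= \int[mu]_x g x.
Proof.
move=> f0 fg.
rewrite !ge0_integralTE//; last by move=> x; exact: le_trans (fg x).
apply: ge_ereal_sup => _ [h /= hf <-].
by apply: ereal_sup_ubound; exists h => //= x; exact: le_trans (fg x).
Qed.

(** Reduces a bound on the integral of [f] plus [x] to the simple functions below [f]. A finite [x]
    is moved to the right before taking the supremum; if [x] is [+oo], then [h = 0] already forces
    [c = +oo]. *)
Lemma ge0_integral_nonmeasD_le d (T : measurableType d) (R : realType)
    (mu : {measure set T -> \bar R}) (f : T -> \bar R) (x c : \bar R) :
  (forall t, 0 <= f t) -> 0 <= x ->
  (forall h : {nnsfun T >-> R}, (forall t, (h t)%:E <= f t) ->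
    \int[mu]_t (h t)%:E + x <= c) ->
  \int[mu]_t f t + x <= c.
Proof.
move=> f0 x0 hc; have [xy|] := eqVneq x +oo.
  have := hc nnsfun0 f0; rewrite xy integralT_nnsfun sintegral0 add0e leye_eq.
  by move=> /eqP ->; exact: leey.
rewrite -ltey => xy; have xfin : x \is a fin_num by rewrite ge0_fin_numE.
rewrite -leeBrDr// ge0_integralTE//; apply: ge_ereal_sup => _ [h /= hf <-].
by rewrite leeBrDr// -integralT_nnsfun; exact: hc.
Qed.

(** If simple [h] and [k] lie below [f] and [g], then [h + k] lies below [f + g], and the integral
    is additive on simple functions. *)
Lemma ge0_integral_nonmeas_superD d (T : measurableType d) (R : realType)
    (mu : {measure set T -> \bar R}) (f g : T -> \bar R) :
  (forall x, 0 <= f x) -> (forall x, 0 <= g x) ->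
  \int[mu]_x f x + \int[mu]_x g x <= \int[mu]_x (f x + g x).
Proof.
move=> f0 g0; apply: ge0_integral_nonmeasD_le => //; first exact: integral_ge0.
move=> h hf; rewrite addeC; apply: ge0_integral_nonmeasD_le => //.
  by apply: integral_ge0 => x _; rewrite lee_fin.
move=> k kg; rewrite addeC -ge0_integralD//; last 4 first.
- by move=> x _; rewrite lee_fin.
- exact/measurable_EFinP.
- by move=> x _; rewrite lee_fin.
- exact/measurable_EFinP.
apply: ge0_le_integral_nonmeas => x; first by rewrite adde_ge0// ?lee_fin.
exact: leeD.
Qed.

Lemma ge0_integral_nonmeas_cstD d (T : measurableType d) (R : realType)
    (mu : probability T R) (f : T -> \bar R) (k : R) :
  (forall x, 0 <= f x) -> (0 <= k)%R ->
  \int[mu]_x (f x + k%:E) <= \int[mu]_x f x + k%:E.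
Proof.
move=> f0 k0; rewrite ge0_integralTE; last first.
  by move=> x; rewrite adde_ge0// ?lee_fin.
apply: ge_ereal_sup => _ [h /= hf <-]; rewrite -integralT_nnsfun.
(* Truncating at 0 keeps [g] nonnegative and below [f], while [h <= g + k]; the constant integrates
   to [k] since [mu] has mass 1. *)
pose g x : R := Num.max (h x - k)%R 0%R.
have mg : measurable_fun setT (EFin \o g).
  apply/measurable_EFinP; apply: measurable_maxr => //.
  exact: measurable_funB.
have g0 x : 0 <= (g x)%:E by rewrite lee_fin le_max lexx orbT.
apply: (@le_trans _ _ (\int[mu]_x ((g x)%:E + cst k%:E x))).
  apply: ge0_le_integral_nonmeas => x /=; first by rewrite lee_fin.
  by rewrite lee_fin -lerBlDr le_max lexx.
rewrite ge0_integralD//.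
have mu1 := probability_setT mu.
rewrite integral_cst// [X in _ * X]mu1 mule1 leeD2r//.
apply: ge0_le_integral_nonmeas => // x.
by rewrite EFin_max EFinB ge_max f0 andbT leeBlDr.
Qed.

Lemma ge0_integral_nonmeas_Zl d (T : measurableType d) (R : realType)
    (mu : {measure set T -> \bar R}) (f : T -> \bar R) (k : R) :
  (forall x, 0 <= f x) -> (0 < k)%R ->
  \int[mu]_x (k%:E * f x) <= k%:E * \int[mu]_x f x.
Proof.
move=> f0 k0; rewrite ge0_integralTE; last first.
  by move=> x; rewrite mule_ge0// ?lee_fin ltW.
apply: ge_ereal_sup => _ [h /= hf <-]; rewrite -integralT_nnsfun.
(* The function [h / k] is measurable and lies below [f]. *)
rewrite -lee_pdivrMl// -ge0_integralZl//; last 3 first.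
- exact/measurable_EFinP.
- by move=> x _; rewrite lee_fin.
- by rewrite lee_fin invr_ge0 ltW.
apply: ge0_le_integral_nonmeas => x; last by rewrite lee_pdivrMl.
by rewrite mule_ge0// ?lee_fin// invr_ge0 ltW.
Qed.

Section Costs.
Context (R : realType) (d : nat) (disp : measure_display)
  (Omega : measurableType disp) (P : probability Omega R) (S : lqg (d := d) P).

Lemma cost_ge0 (B : strategy S) a : 0 <= cost B a.
Proof.
apply: integral_ge0 => w _; apply: integral_ge0 => t _; rewrite lee_fin.
apply: addr_ge0; first by case: (Qw_psd S).
have [_ Rpos] := Rw_pd S.
have [->|/Rpos/ltW//] := eqVneq (control B a w t) 0%R.
by rewrite mulmx0 mxE.
Qed.

Lemma opt_cost_ge0 a : 0 <= opt_cost S a.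
Proof. by apply: le_ereal_inf_tmp => _ [B _ <-]; exact: cost_ge0. Qed.

Lemma opt_cost_le (B : strategy S) a : opt_cost S a <= cost B a.
Proof. by apply: ereal_inf_lbound; exists B. Qed.

Lemma cost_le_AR (B : strategy S) a (k : R) :
  (0 <= k)%R -> AR B a <= k%:E -> cost B a <= opt_cost S a + k%:E.
Proof.
rewrite /AR => k0; have := opt_cost_le B a; have := opt_cost_ge0 a.
case: (opt_cost S a) => [r| |]// r0; last by rewrite addye// leey.
by move=> _; rewrite leeBlDl.
Qed.

(** The positive part matters where the optimal cost is [+oo]: there [AR B a] is
    [+oo - +oo = -oo]. *)
Lemma ARpos_opt_cost (B : strategy S) a :
  (AR B)^\+ a + opt_cost S a <= cost B a.
Proof.
rewrite funeposE /AR; have := opt_cost_le B a; have := opt_cost_ge0 a.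
case: (opt_cost S a) => [r| |]// r0 le_rc.
  by rewrite max_l ?subeK// leeBrDr// add0e.
by move: le_rc; rewrite leye_eq => /eqP ->; exact: leey.
Qed.

Lemma MR_opt_cost_ge0 (B : strategy S) a : 0 <= MR B a * opt_cost S a.
Proof.
by rewrite !mule_ge0 ?inve_ge0 ?cost_ge0 ?opt_cost_ge0.
Qed.

(* The left-hand side is 0 when the optimal cost is 0 or +oo. *)
Lemma MR_opt_cost_le (B : strategy S) a : MR B a * opt_cost S a <= cost B a.
Proof.
rewrite /MR; have := cost_ge0 B a; have := opt_cost_ge0 a.
case: (opt_cost S a) => [r| |]// r0 c0; last by rewrite invey mule0 mul0e.
have [->|rn0] := eqVneq r 0%R; first by rewrite mule0.
by rewrite inver (negbTE rn0) -muleA -EFinM mulVf// mule1.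
Qed.

(** At optimal cost 0, a finite ratio forces the cost to be 0; at optimal cost [+oo], the right-hand
    side is [+oo] because [k > 0]. *)
Lemma cost_le_MR (B : strategy S) a (k : R) :
  (0 < k)%R -> MR B a <= k%:E -> cost B a <= k%:E * opt_cost S a.
Proof.
rewrite /MR => k0; have := cost_ge0 B a; have := opt_cost_ge0 a.
case: (opt_cost S a) => [r| |]// r0 c0; last by rewrite gt0_muley ?leey.
have [->|rn0] := eqVneq r 0%R.
  rewrite inve0 mule0; move: c0; rewrite le_eqVlt => /predU1P[<-//|c0].
  by rewrite gt0_muley.
rewrite inver (negbTE rn0) lee_pdivrMr//.
by rewrite lt_neqAle eq_sym rn0 -lee_fin.
Qed.

Lemma MR_eq0 (B : strategy S) a :
  MR B a = 0 -> opt_cost S a = 0 \/ opt_cost S a = +oo.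
Proof.
rewrite /MR => /eqP; rewrite mule_eq0 inve_eq0.
move=> /orP[/eqP c0|/eqP ->]; [left|by right].
apply/eqP; rewrite eq_le opt_cost_ge0 andbT -c0.
exact: opt_cost_le.
Qed.

End Costs.

Theorem theorem1 (R : realType) (d : nat) (disp : measure_display)
    (Omega : measurableType disp) (P : probability Omega R)
    (S : lqg (d := d) P) (mu : probability (borel_vec R d) R)
    (A B : strategy S) :
  \int[mu]_a opt_cost S a < +oo ->
  bayesian mu A ->
  (AR_agnostic B ->
     \int[mu]_a AR A a <= AR_worst B /\ AR_worst B <= AR_worst A) /\
  (MR_agnostic B ->
     (\int[mu]_a (MR A a * opt_cost S a)) / (\int[mu]_a opt_cost S a)
       <= MR_worst B /\
     MR_worst B <= MR_worst A).
Proof.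
move=> optoo bayesA.
have opt0 := @opt_cost_ge0 _ _ _ _ _ S.
have optI0 : 0 <= \int[mu]_a opt_cost S a by exact: integral_ge0.
have optfin : \int[mu]_a opt_cost S a \is a fin_num by rewrite ge0_fin_numE.
split=> [agn|agn]; split; try exact: agn.
- have AR_leB a : AR B a <= AR_worst B by apply: ereal_sup_ubound; exists a.
  (* The regret is known to be nonnegative only where the optimal cost is finite, so one such point
     is needed to get [0 <= AR_worst B]. *)
  have [a opta] : exists a, opt_cost S a < +oo.
    apply: contrapT => /forallNP opty.
    have : \int[mu]_a opt_cost S a = +oo.
      rewrite (eq_integral (cst +oo)); last first.
        by move=> a _; move: (opty a) => /negP; rewrite -leNgt leye_eq => /eqP.
      have mu1 := probability_setT mu.
      by rewrite integral_cst// [X in _ * X]mu1 mule1.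
    by move=> E; move: optoo; rewrite E ltxx.
  have : 0 <= AR_worst B.
    apply: le_trans (AR_leB a).
    by rewrite /AR leeBrDr ?add0e ?opt_cost_le// ge0_fin_numE.
  case worstE : (AR_worst B) => [k| |]// k0; last exact: leey.
  have costB a' : cost B a' <= opt_cost S a' + k%:E.
    by apply: cost_le_AR => //; rewrite -worstE.
  (* The integral of [AR A] is that of its positive part minus that of its negative part. *)
  apply: (@le_trans _ _ (\int[mu]_a (AR A)^\+ a)).
    by rewrite integralE geeDl// oppe_le0 integral_ge0.
  rewrite -(leeD2rE _ _ optfin).
  apply: le_trans; first exact: ge0_integral_nonmeas_superD.
  apply: (@le_trans _ _ (expected_cost mu A)).
    apply: ge0_le_integral_nonmeas => a'; first by rewrite adde_ge0.
    exact: ARpos_opt_cost.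
  apply: le_trans (bayesA B) _.
  apply: (@le_trans _ _ (\int[mu]_a (opt_cost S a + k%:E))).
    by apply: ge0_le_integral_nonmeas => // a'; exact: cost_ge0.
  by rewrite [leRHS]addeC; exact: ge0_integral_nonmeas_cstD.
- have MR_leB a : MR B a <= MR_worst B by apply: ereal_sup_ubound; exists a.
  have MR0 a : 0 <= MR B a.
    by rewrite mule_ge0 ?inve_ge0 ?cost_ge0 ?opt_cost_ge0.
  have : 0 <= MR_worst B by exact: le_trans (MR_leB 0%R).
  case worstE : (MR_worst B) => [k| |]//; [|by move=> _; exact: leey].
  rewrite le_eqVlt => /predU1P[[k0]|k_gt0].
  (* Here the optimal cost takes only the values 0 and +oo, and the bound
     c_B <= k o fails where it is +oo, as 0 * +oo = 0. *)
  - rewrite integral0_eq ?mul0e -?k0// => a _.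
    have /MR_eq0[->|opty] : MR B a = 0; last 2 first.
    + by rewrite mule0.
    + by rewrite /MR opty invey mule0 mul0e.
    by apply/eqP; rewrite eq_le MR0 andbT (le_trans (MR_leB a))// worstE -k0.
  have le_num : \int[mu]_a (MR A a * opt_cost S a)
      <= k%:E * \int[mu]_a opt_cost S a.
    apply: (@le_trans _ _ (expected_cost mu A)).
      apply: ge0_le_integral_nonmeas => a; first exact: MR_opt_cost_ge0.
      exact: MR_opt_cost_le.
    apply: le_trans (bayesA B) _.
    apply: (@le_trans _ _ (\int[mu]_a (k%:E * opt_cost S a))); last first.
      exact: ge0_integral_nonmeas_Zl.
    apply: ge0_le_integral_nonmeas => a; first exact: cost_ge0.
    by apply: cost_le_MR => //; rewrite -worstE.
  have num0 : 0 <= \int[mu]_a (MR A a * opt_cost S a).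
    by apply: integral_ge0 => a _; exact: MR_opt_cost_ge0.
  move: optoo optI0 le_num; case: (\int[mu]_a opt_cost S a) => [r| |]// _ r0.
  (* With a zero denominator the numerator is 0 too, and [0 / 0 = 0 * +oo = 0]. *)
  have [->|rn0] := eqVneq r 0%R.
    rewrite mule0 => num_le0.
    suff -> : \int[mu]_a (MR A a * opt_cost S a) = 0 by rewrite mul0e ltW.
    by apply/eqP; rewrite eq_le num_le0.
  rewrite inver (negbTE rn0) lee_pdivrMr// lt_neqAle eq_sym rn0.
  by rewrite -lee_fin.
Qed.
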